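(* Let $S\subset\mathbb{R}^2$ be a set of $n$ points in general position and let $k$ be an integer with $0\leq k\leq \lfloor n/3\rfloor-1$. If $E_k(S)=3\binom{k+2}{2}$, then $E_j(S)=3\binom{j+2}{2}$ for every integer $j$ with $0\leq j\leq k$.
   Context: A finite set $S\subset\mathbb{R}^2$ is in general position if no three of its points are collinear. A $j$-edge of $S$ is an oriented segment $\overrightarrow{pq}$, i.e. an ordered pair $(p,q)$ of distinct points of $S$, such that exactly $j$ points of $S$ lie in the open half-plane to the right of the line through $p$ and $q$ oriented from $p$ to $q$ (the ''positive side''). The number of $j$-edges of $S$ is denoted $e_j(S)$, and $E_k(S)=\sum_{j=0}^{k}e_j(S)$ is the number of $(\leq k)$-edges of $S$. *)

(* Defs.v *)
From HB Require Import structures.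
From mathcomp Require Export all_boot all_order all_algebra finmap.
From mathcomp Require Export reals.

Set Implicit Arguments.
Unset Strict Implicit.
Unset Printing Implicit Defensive.

Import GRing.Theory Num.Theory.

Local Open Scope fset_scope.
Local Open Scope ring_scope.

Section JEdges.
Variable R : realType.

Definition dot (u v : R * R) : R := u.1 * v.1 + u.2 * v.2.

(* The points lie on a common line {x | dot u x = c}, u being a nonzero
   normal vector. *)
Definition collinear (p q r : R * R) : Prop :=
  exists (u : R * R) (c : R),
    u != 0 /\ [/\ dot u p = c, dot u q = c & dot u r = c].

Definition general_position (S : {fset R * R}) : Prop :=
  forall p q r : R * R, p \in S -> q \in S -> r \in S ->
    p != q -> p != r -> q != r -> ~ collinear p q r.

(* Clockwise rotation by a right angle. *)
Definition right_normal (v : R * R) : R * R := (v.2, - v.1).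

(* r lies strictly to the right of the line pq oriented from p to q. *)
Definition right_of (p q r : R * R) : bool :=
  0 < dot (right_normal (q - p)) (r - p).

Definition is_jedge (j : nat) (S : {fset R * R}) (pq : (R * R) * (R * R)) :=
  [&& pq.1 \in S, pq.2 \in S, pq.1 != pq.2
    & #|` [fset r in S | right_of pq.1 pq.2 r]| == j].

Definition jedges (j : nat) (S : {fset R * R}) : nat :=
  #|` [fset pq in S `*` S | is_jedge j S pq]|.

Definition le_kedges (k : nat) (S : {fset R * R}) : nat :=
  (\sum_(0 <= j < k.+1) jedges j S)%N.

End JEdges.

(* Main.v *)
Require Import Defs.
From mathcomp Require Import ring lra zify.

(** Rotating a line about a point x changes the number of points on its right by
    one at a time, so a point x that can be cut off together with at most k other
    points is the tail of a k-edge.  Applied to the k+1 points that come first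
    around a hull vertex a, this gives k+1 k-edges having a on their left;
    together with the 2(k+1) (<=k)-edges at a it yields
    E_k(S) >= E_{k-1}(S \ a) + 3(k+1), hence E_k >= 3 binom(k+2, 2).

    If E_k(S) is tight, so is E_{k-1}(S \ a) for every hull vertex a, and by
    induction each S \ a has a triangular hull, which forces the hull of S to be
    a triangle abc.  Counting the edges at a, b, c gives
    E_k(S) >= 6k + 3 + E_{k-2}(S \ abc) + x, where x is the number of k-edges
    between inner points with exactly one hull vertex on their right; so x = 0.
    Hence the first k+1 points around a, counted from b, are also the last k+1
    points around c, and likewise for the two rotations of (a, b, c).  These
    three sets of k+1 points are pairwise disjoint and each of their points is
    the tail of a k-edge, so e_k(S) >= 3(k+1) and E_{k-1}(S) is tight. *)

Import Order.TTheory GRing.Theory Num.Theory.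

(** * Finite sets: greatest elements, ranks and counting *)

Section FiniteSets.
Local Set Implicit Arguments.
Local Unset Strict Implicit.

(** An element with the most elements below it is the greatest: any element not below it would lie
    above it and, by transitivity, have more below. *)
Lemma transitive_max (T : finType) (Y : {set T}) (r : rel T) :
  Y != set0 ->
  {in Y & &, forall x y z, r x y -> r y z -> r x z} ->
  {in Y &, forall x y, x != y -> r x y = ~~ r y x} ->
  exists2 z, z \in Y & {in Y, forall y, y != z -> r y z}.
Proof.
case/set0Pn=> y0 Yy0 tr tot.
case: (@arg_maxnP _ y0 (mem Y) (fun z => #|[set y in Y | r y z & y != z]|) Yy0).
move=> z /= Yz zmax; exists z => // y Yy nyz.
apply/negPn/negP=> nryz.
have rzy : r z y by rewrite tot // eq_sym.
have := zmax y Yy; rewrite leqNgt => /negP; apply; apply: proper_card.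
apply/properP; split.
  apply/subsetP=> u; rewrite !inE => /and3P[Yu ruz nuz]; rewrite Yu /=.
  rewrite (tr u z y) //=; apply: contraNneq nryz => <-; exact: ruz.
by exists z; rewrite !inE Yz ?rzy ?eqxx ?andbF //= eq_sym.
Qed.

(* [f] is forced to be a bijection from [B] onto {0, ..., #|B| - 1}. *)
Lemma card_rank_lt (T : finType) (B : {set T}) (f : T -> nat) (m : nat) :
  {in B &, injective f} -> {in B, forall x, f x < #|B|}%N -> (m <= #|B|)%N ->
  #|[set x in B | (f x < m)%N]| = m.
Proof.
move=> finj fB mB.
have uf : uniq (map f (enum B)).
  rewrite map_inj_in_uniq ?enum_uniq // => x y.
  by rewrite !mem_enum; apply: finj.
have sz : size (map f (enum B)) = #|B| by rewrite size_map -cardE.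
have sub : {subset map f (enum B) <= iota 0 #|B|}.
  by move=> i /mapP[x]; rewrite mem_enum mem_iota => xB ->; rewrite fB.
have pe : perm_eq (map f (enum B)) (iota 0 #|B|).
  apply: uniq_perm; rewrite ?iota_uniq //.
  by apply: (uniq_min_size uf sub _).2; rewrite size_iota sz.
rewrite -sum1dep_card.
have -> : (\sum_(x in B | (f x < m)%N) 1 = count (fun i => i < m) (map f (enum B)))%N.
  by rewrite -big_enum_cond /= count_map -sum1_count.
rewrite (permP pe) -size_filter.
have -> : [seq i <- iota 0 #|B| | (i < m)%N] = iota 0 m.
  have /subnKC <- := mB.
  rewrite iotaD filter_cat add0n (@eq_in_filter _ _ predT) ?filter_predT.
    rewrite (@eq_in_filter _ _ pred0) ?filter_pred0 ?cats0 // => i.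
    by rewrite mem_iota => /andP[+ _]; rewrite leqNgt => /negbTE.
  by move=> i; rewrite mem_iota add0n.
by rewrite size_iota.
Qed.

Lemma card_setD1_geq (T : finType) (A : {set T}) (a : T) : (#|A| <= #|A :\ a|.+1)%N.
Proof. by rewrite (cardsD1 a); case: (a \in A). Qed.

Lemma sum_card_disjoint (T : finType) (X : {set T}) (Ys : seq {set T}) :
  all (fun Y : {set T} => Y \subset X) Ys ->
  pairwise (fun Y Z : {set T} => [disjoint Y & Z]) Ys ->
  (sumn (map (fun Y : {set T} => #|Y|) Ys) <= #|X|)%N.
Proof.
elim: Ys X => //= Y Ys IH X /andP[YX YsX] /andP[dY dYs].
rewrite -(cardsID Y X) (setIidPr YX) leq_add2l; apply: IH => //.
apply/allP=> Z ZYs; rewrite subsetD (allP YsX) //=.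
by rewrite disjoint_sym (allP dY).
Qed.

Lemma card_pairs_fst (T : finType) (P : {set T}) (Q : rel T) :
  #|[set pq : T * T | (pq.1 \in P) && Q pq.1 pq.2]|
  = (\sum_(p in P) #|[set q | Q p q]|)%N.
Proof.
rewrite -sum1dep_card -(@pair_big_dep _ _ _ _ _ (mem P) Q (fun _ _ => 1%N)) /=.
by apply: eq_bigr => p _; rewrite sum1dep_card.
Qed.

Lemma card_pairs_snd (T : finType) (P : {set T}) (Q : rel T) :
  #|[set pq : T * T | (pq.2 \in P) && Q pq.1 pq.2]|
  = (\sum_(q in P) #|[set p | Q p q]|)%N.
Proof.
rewrite -(card_pairs_fst P (fun q p => Q p q)).
have inj : injective (fun pq : T * T => (pq.2, pq.1)) by move=> [p q] [? ?] [-> ->].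
rewrite -(card_imset _ inj); apply: eq_card => -[p q]; rewrite !inE /=.
apply/imsetP/idP => [[[u v]] | Pq].
  by rewrite inE /= => ? [-> ->].
by exists (q, p); rewrite ?inE.
Qed.

End FiniteSets.

(** * Orientation of triples and angular orders *)

Section Planar.
Local Set Implicit Arguments.
Local Unset Strict Implicit.
Local Open Scope ring_scope.
Variable R : realFieldType.

Definition det (p q r : R * R) : R :=
  (q.1 - p.1) * (r.2 - p.2) - (q.2 - p.2) * (r.1 - p.1).

(** The three-term Grassmann-Plücker relation, the source of the transitivity lemmas below. *)
Lemma det_plucker (x a b c d : R * R) :
  det x a b * det x c d - det x a c * det x b d + det x a d * det x b c = 0.
Proof. rewrite /det; ring. Qed.

Lemma det_cycle (p q r : R * R) : det p q r = det q r p.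
Proof. rewrite /det; ring. Qed.

Lemma det_swap (p q r : R * R) : det p r q = - det p q r.
Proof. rewrite /det; ring. Qed.

(** The relation writes [det x s q * det x p r] as a sum of two positive products. Arbitrary points
    are allowed because [extreme_exists] takes for [s] a point that may lie outside the
    configuration. *)
Lemma det_trans_left (x s p q r : R * R) :
  0 < det x s p -> 0 < det x s q -> 0 < det x s r ->
  0 < det x p q -> 0 < det x q r -> 0 < det x p r.
Proof.
move=> sp sq sr pq qr; rewrite -(pmulr_rgt0 _ sq).
have := det_plucker x s p q r.
by have := mulr_gt0 sp qr; have := mulr_gt0 sr pq; lra.
Qed.

Variables (T : finType) (pt : T -> R * R).
Hypothesis pt_inj : injective pt.
Hypothesis gp : forall p q r, p != q -> p != r -> q != r ->
  det (pt p) (pt q) (pt r) != 0.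

Definition ccw (p q r : T) : bool := 0 < det (pt p) (pt q) (pt r).

Lemma ccw_cycle p q r : ccw p q r = ccw q r p.
Proof. by rewrite /ccw det_cycle. Qed.

Lemma ccw_asym p q r : ccw p q r -> ccw p r q = false.
Proof. by rewrite /ccw (det_swap _ (pt q)) oppr_gt0 => /lt_gtF. Qed.

Lemma ccwpp p q : ccw p q q = false.
Proof. by apply/negP=> h; have := ccw_asym h; rewrite h. Qed.

Lemma ccw_neq p q r : ccw p q r -> [/\ p != q, p != r & q != r].
Proof.
move=> h; split; apply: contraTneq h => ->; rewrite ?ccwpp //.
  by rewrite ccw_cycle ccw_cycle ccwpp.
by rewrite ccw_cycle ccwpp.
Qed.

Lemma ccw_total p q r : p != q -> p != r -> q != r -> ccw p q r = ~~ ccw p r q.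
Proof.
move=> pq pr qr; have := gp pq pr qr.
by rewrite /ccw (det_swap (pt p) (pt q)) oppr_gt0 -leNgt le0r => /negbTE ->.
Qed.

Lemma ccw_trans_left x s p q r :
  ccw x s p -> ccw x s q -> ccw x s r -> ccw x p q -> ccw x q r -> ccw x p r.
Proof. exact: det_trans_left. Qed.

Lemma ccw_trans_right x s p q r :
  ccw x p s -> ccw x q s -> ccw x r s -> ccw x p q -> ccw x q r -> ccw x p r.
Proof.
rewrite /ccw => ps qs rs pq qr; rewrite -(pmulr_rgt0 _ qs).
have := det_plucker (pt x) (pt p) (pt q) (pt r) (pt s).
by have := mulr_gt0 rs pq; have := mulr_gt0 ps qr; lra.
Qed.

(* Seen from [x], [y] lies in the cone between the directions of [c] and of the
   antipode of [a], whereas [r] lies on the clockwise side of both. *)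
Lemma ccw_cone x a c y r :
  ccw x c a -> ccw x y a -> ccw x y c -> ccw x a r -> ccw x r c -> ccw x r y.
Proof.
rewrite /ccw => ca ya yc ar rc; rewrite -(pmulr_rgt0 _ ca).
have := det_plucker (pt x) (pt c) (pt a) (pt r) (pt y).
rewrite (det_swap _ (pt r) (pt c)) (det_swap _ (pt y) (pt c)).
rewrite (det_swap _ (pt y) (pt a)).
by have := mulr_gt0 ya rc; have := mulr_gt0 ar yc; lra.
Qed.

(** * Points to the right of a line, and hull vertices *)

Definition right (A : {set T}) (p q : T) : {set T} := [set r in A | ccw p r q].

Definition nright (A : {set T}) (p q : T) : nat := #|right A p q|.

Lemma nright_opp (A : {set T}) p q : p \in A -> q \in A -> p != q ->
  (nright A p q + nright A q p + 2)%N = #|A|.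
Proof.
move=> pA qA pq.
have -> : 2%N = #|[set p; q]| by rewrite cards2 pq.
rewrite -(cardsID [set p; q] A) addnC; congr (_ + _)%N.
  by apply/esym/eq_card => r; rewrite !inE; case: eqP => [->|]; case: eqP => [->|];
     rewrite ?pA ?qA ?andbF.
rewrite -(cardsID (right A p q) (A :\: _)); congr (_ + _)%N; apply: eq_card => r; rewrite !inE.
  case rA: (r \in A); rewrite ?andbF //= andbT.
  case prq: (ccw p r q); rewrite ?andbF ?andbT //=.
  by have [+ _ ?] := ccw_neq prq; rewrite eq_sym => /negbTE -> /=; apply/esym.
case rA: (r \in A); rewrite ?andbF //= andbT.
have [->|rp] := eqVneq r p; first by rewrite ccwpp andbF.
have [->|rq] := eqVneq r q; first by rewrite [ccw q q p]ccw_cycle ccw_cycle ccwpp andbF.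
by rewrite andbT [ccw q r p]ccw_cycle ccw_cycle (@ccw_total p q r) ?negbK // eq_sym.
Qed.

(* Being a vertex of the convex hull of [A] is encoded as transitivity of the
   angular order of [A] around [a]. *)
Definition extreme (A : {set T}) (a : T) : bool :=
  (a \in A) && [forall p in A, forall q in A, forall r in A,
                  ccw a p q ==> ccw a q r ==> ccw a p r].

Lemma extremeP (A : {set T}) a :
  reflect (a \in A /\ {in A & &, forall p q r, ccw a p q -> ccw a q r -> ccw a p r})
          (extreme A a).
Proof.
apply: (iffP andP) => -[aA tr]; split=> //.
  move=> p q r pA qA rA pq qr.
  move/forall_inP/(_ p pA)/forall_inP/(_ q qA)/forall_inP/(_ r rA): tr.
  by rewrite pq qr.
apply/forall_inP=> p pA; apply/forall_inP=> q qA; apply/forall_inP=> r rA.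
by apply/implyP=> pq; apply/implyP=> qr; apply: (tr p q r).
Qed.

Lemma extreme_sub (A B : {set T}) a :
  B \subset A -> a \in B -> extreme A a -> extreme B a.
Proof.
move=> /subsetP BA aB /extremeP[_ tr]; apply/extremeP; split=> // p q r *.
by apply: (tr p q r); rewrite ?BA.
Qed.

(* A point at maximal distance from the origin is extreme: all other points lie
   in the open half-plane bounded by the tangent to the circle through it. *)
Lemma extreme_exists (A : {set T}) : A != set0 -> exists a, extreme A a.
Proof.
case/set0Pn=> a0 Aa0; pose nrm (p : T) := (pt p).1 ^+ 2 + (pt p).2 ^+ 2.
case: (@Order.TotalTheory.arg_maxP _ _ T a0 (mem A) nrm Aa0) => a /= aA amax.
exists a; apply/extremeP; split=> // p q r pA qA rA pq qr.
(* The determinant equals |a|^2 - a.z, whose double is |z - a|^2 + (|a|^2 - |z|^2) > 0. *)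
have half z : z \in A -> z != a ->
    0 < det (pt a) ((pt a).1 - (pt a).2, (pt a).2 + (pt a).1) (pt z).
  move=> zA za; have := amax z zA; rewrite /nrm /det /=.
  have : 0 < ((pt z).1 - (pt a).1) ^+ 2 + ((pt z).2 - (pt a).2) ^+ 2.
    rewrite lt0r addr_ge0 ?sqr_ge0 // andbT paddr_eq0 ?sqr_ge0 //.
    apply: contraNN za; rewrite !sqrf_eq0 !subr_eq0 => /andP[/eqP e1 /eqP e2].
    by apply/eqP/pt_inj; case: (pt z) (pt a) e1 e2 => [? ?] [? ?] /= -> ->.
  nra.
have [pa _ _] := ccw_neq pq; have [qa ra _] := ccw_neq qr.
by apply: det_trans_left pq qr; apply: half; rewrite // eq_sym.
Qed.

(** * Rotating a line about a point *)

Local Open Scope nat_scope.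

(** [Y] holds the points that the forward ray meets while turning clockwise from [w] to the antipode
    of [a]. If there are none, the right side of [x -> w] lies within that of [a -> x]; otherwise
    [z] is the first one met, and only [z] can leave the right side. *)
Lemma right_step (A : {set T}) a x w : w = a \/ ccw x w a ->
  right A x w \subset right A a x \/
  exists2 z, z \in A &
    [/\ ccw x z a, ccw x z w & right A x w \subset z |: right A x z].
Proof.
move=> wa; pose Y := [set z in A | ccw x z a && ccw x z w].
have side r : ccw x r w -> ccw x r a || ccw x a r.
  move=> rw; have [xr xw _] := ccw_neq rw.
  have ra : r != a.
    apply: contraTneq rw => ->; case: wa => [->|wa]; first by rewrite ccwpp.
    by rewrite (ccw_asym wa).
  have xa : x != a by case: wa => [<- //|/ccw_neq[]].
  by rewrite (ccw_total xr xa ra) orNb.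
have [Y0|Yn0] := eqVneq Y set0; [left|right].
  apply/subsetP=> r; rewrite !inE => /andP[rA rw]; rewrite rA /= ccw_cycle ccw_cycle.
  case/orP: (side r rw) => // ra.
  by move/setP/(_ r): Y0; rewrite !inE rA ra rw.
have [|u v|z] := transitive_max (r := ccw x) Yn0.
- move=> u v t; rewrite !inE => /and3P[_ ua _] /and3P[_ va _] /and3P[_ ta _].
  exact: ccw_trans_right ua va ta.
- rewrite !inE => /and3P[_ /ccw_neq[xu _ _] _] /and3P[_ /ccw_neq[xv _ _] _].
  exact: ccw_total.
rewrite !inE => /and3P[zA za zw] zmax; exists z => //; split=> //.
apply/subsetP=> r; rewrite !inE => /andP[rA rw]; rewrite rA /=.
have [//|nrz] := eqVneq r z; case/orP: (side r rw) => ra.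
  by apply: zmax; rewrite // !inE rA ra.
case: wa => [wa|wa]; first by rewrite wa (ccw_asym ra) in rw.
exact: ccw_cone wa za zw ra rw.
Qed.

(* A discrete intermediate value property: while a line rotates about [x] from
   the direction of [a -> x] to that of [x -> w], the number of points on its
   right changes by one at each point that it meets, and it increases exactly at
   the points met by the forward ray. *)
Lemma rotation (A : {set T}) a x w m : w = a \/ ccw x w a ->
  nright A a x <= m -> m < nright A x w ->
  exists2 y, y \in A & [/\ nright A x y = m, ccw x y a & ccw x y w].
Proof.
(* Induction on the points still ahead of the forward ray: moving [w] to the next such point lowers
   the count by at most one, so [m] cannot be skipped. *)
move=> + am; have [n] := ubnP #|[set z in A | ccw x z a && ccw x z w]|.
elim: n w => // n IH w; rewrite ltnS => cardY wa mw.
have [sub|[z zA [za zw sub]]] := right_step A wa.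
  by have := leq_trans mw (leq_trans (subset_leq_card sub) am); rewrite ltnn.
have := subset_leq_card sub; rewrite cardsU1 -/(nright A x z) -/(nright A x w) => le_wz.
have [eq_zm|neq_zm] := eqVneq (nright A x z) m; first by exists z.
have mz : m < nright A x z by case: (_ \in _) le_wz => /=; lia.
have [||//|y yA [ym ya yz]] := IH z; [|by right|].
  apply: leq_trans cardY; apply: proper_card; apply/properP; split.
    apply/subsetP=> u; rewrite !inE => /and3P[-> ua uz]; rewrite ua /=.
    by case: wa => [->//|wa]; exact: ccw_trans_right ua za wa uz zw.
  by exists z; rewrite !inE zA za ?zw //= ccwpp.
exists y => //; split=> //.
by case: wa => [->//|wa]; exact: ccw_trans_right ya za wa yz zw.
Qed.

(** * Ranks around a hull vertex *)

Lemma nright_lt (A : {set T}) a x y : extreme A a -> x \in A -> y \in A ->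
  ccw a x y -> nright A a x < nright A a y.
Proof.
move=> /extremeP[_ tr] xA yA xy; apply: proper_card; apply/properP; split.
  apply/subsetP=> r; rewrite !inE => /andP[rA rx]; rewrite rA /=.
  exact: tr rx xy.
by exists x; rewrite !inE xA ?xy // ccwpp.
Qed.

Lemma nright_inj (A : {set T}) a : extreme A a -> {in A :\ a &, injective (nright A a)}.
Proof.
move=> exa x y; rewrite !inE => /andP[xa xA] /andP[ya yA] eqxy.
apply/eqP; apply: contraT => nxy.
have /orP[xy|yx] : ccw a x y || ccw a y x by rewrite ccw_total ?orNb // eq_sym.
  by move: (nright_lt exa xA yA xy); rewrite eqxy ltnn.
by move: (nright_lt exa yA xA yx); rewrite eqxy ltnn.
Qed.

Lemma nright_lt_pred (A : {set T}) p q : p \in A -> q \in A -> p != q ->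
  nright A p q < #|A|.-1.
Proof. by move=> pA qA pq; have := nright_opp pA qA pq; lia. Qed.

(** For a hull vertex [a], [nright A a] is the rank in counterclockwise order around [a]; when
    [m < #|A|], [outs] and [ins] are the first and the last [m] points of that order. *)
Definition outs (A : {set T}) a m := [set x in A :\ a | nright A a x < m].
Definition ins (A : {set T}) a m := [set x in A :\ a | nright A x a < m].

Lemma card_outs (A : {set T}) a m : extreme A a -> m < #|A| -> #|outs A a m| = m.
Proof.
move=> exa mA; have [aA _] := extremeP _ _ exa; apply: card_rank_lt.
- exact: nright_inj.
- move=> x; rewrite !inE => /andP[xa xA].
  have := cardsD1 a A; have := @nright_lt_pred A a x aA xA.
  by rewrite aA eq_sym xa => /(_ isT); lia.
- by have := cardsD1 a A; rewrite aA; lia.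
Qed.

Lemma card_ins (A : {set T}) a m : extreme A a -> m < #|A| -> #|ins A a m| = m.
Proof.
move=> exa mA; have [aA _] := extremeP _ _ exa; apply: card_rank_lt.
- move=> x y xD yD; have := nright_inj exa xD yD.
  move: xD yD; rewrite !inE => /andP[xa xA] /andP[ya yA] inj eqxy; apply: inj.
  by have := nright_opp xA aA xa; have := nright_opp yA aA ya; lia.
- move=> x; rewrite !inE => /andP[xa xA].
  by have := cardsD1 a A; have := nright_lt_pred xA aA xa; rewrite aA; lia.
- by have := cardsD1 a A; rewrite aA; lia.
Qed.

(** The two counts for [a] and [x] add up to [#|A| - 2], too much for both to be below [m]. *)
Lemma disjoint_outs_ins (A : {set T}) a m : a \in A -> 2 * m < #|A| ->
  [disjoint outs A a m & ins A a m].
Proof.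
move=> aA mA; apply/pred0P=> x; rewrite /= !inE; apply/negP.
case/andP=> /andP[/andP[xa xA] out_x] /andP[_ in_x].
by have := nright_opp xA aA xa; lia.
Qed.

(* Strict bound: [edges A m] consists of the (<= m - 1)-edges of [A]. *)
Definition edges (A : {set T}) m : {set T * T} :=
  [set pq | [&& pq.1 \in A, pq.2 \in A, pq.1 != pq.2 & nright A pq.1 pq.2 < m]].

Definition nedges (A : {set T}) m : nat := #|edges A m|.

Lemma nright_setD1 (A : {set T}) a p q : a \in A ->
  nright A p q = ccw p a q + nright (A :\ a) p q.
Proof.
move=> aA; rewrite /nright (cardsD1 a) inE aA /=; congr (_ + _).
by apply: eq_card => r; rewrite !inE andbA.
Qed.

(* There are [m.+1] such edges out of [a], [m.+1] into [a] and, by [rotation] about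
   the points of [outs A a m.+1], at least [m.+1] that are lost when [a], on their
   left, is deleted. *)
Lemma edges_rec (A : {set T}) a m : extreme A a -> 2 * m.+1 < #|A| ->
  nedges (A :\ a) m + 3 * m.+1 <= nedges A m.+1.
Proof.
move=> exa mA; have [aA _] := extremeP _ _ exa.
pose O := [set (a, x) | x in outs A a m.+1].
pose I := [set (x, a) | x in ins A a m.+1].
pose L := [set pq in edges A m.+1 | [&& pq.1 != a, pq.2 != a,
             nright A pq.1 pq.2 == m & ccw pq.1 pq.2 a]].
have cardO : #|O| = m.+1 by rewrite card_imset ?card_outs //; [lia|move=> ? ? []].
have cardI : #|I| = m.+1 by rewrite card_imset ?card_ins //; [lia|move=> ? ? []].
have cardL : m < #|L|.
  (* Distinct tails give distinct edges, so it suffices to rotate about each [x] in [outs A a m.+1]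
     from [a -> x] to [x -> a]; the count passes from at most [m] to above [m]. *)
  apply: leq_trans (leq_imset_card fst _); rewrite -{1}(card_outs (m := m.+1) exa); last lia.
  apply/subset_leq_card/subsetP=> x; rewrite !inE => /andP[/andP[xa xA] out_x].
  have [|||y yA [ym ya _]] := @rotation A a x a m; [by left|lia| |].
    by have := nright_opp xA aA xa; lia.
  have [xy _ ny] := ccw_neq ya.
  by apply/imsetP; exists (x, y); rewrite // !inE /= xA yA xy xa ny ym ya ltnS leqnn eqxx.
apply: (@leq_trans (m.+1 + (m.+1 + (nedges (A :\ a) m + #|L|)))); first by move: cardL; lia.
have := @sum_card_disjoint _ (edges A m.+1) [:: O; I; edges (A :\ a) m; L].
rewrite /= !andbT cardO cardI addn0 => H.
apply: H.
  apply/and4P; split.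
  - apply/subsetP=> _ /imsetP[x + ->]; rewrite !inE /= => /andP[/andP[xa xA] ->].
    by rewrite aA xA eq_sym xa.
  - apply/subsetP=> _ /imsetP[x + ->]; rewrite !inE /= => /andP[/andP[xa xA] ->].
    by rewrite aA xA xa.
  - apply/subsetP=> -[p q]; rewrite !inE /= => /and4P[/andP[_ ->] /andP[_ ->] -> pq].
    by rewrite (nright_setD1 _ _ aA); case: (ccw p a q); rewrite /=; lia.
  - by apply/subsetP=> pq; rewrite inE => /andP[].
have dis (X Y : {set T * T}) : (forall p q, (p, q) \in X -> (p, q) \in Y -> false) ->
    [disjoint X & Y].
  by move=> XY; apply/pred0P=> -[p q] /=; apply/negP=> /andP[/XY h /h].
apply/and3P; split; [apply/and3P; split|apply/andP; split|]; apply: dis => p q.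
- move=> /imsetP[x + [-> ->]] /imsetP[y _ [_ eqx]].
  by rewrite !inE eqx eqxx.
- by move=> /imsetP[x _ [-> _]]; rewrite !inE /= eqxx.
- by move=> /imsetP[x _ [-> _]]; rewrite !inE /= eqxx !andbF.
- by move=> /imsetP[x _ [_ ->]]; rewrite !inE /= eqxx !andbF.
- by move=> /imsetP[x _ [_ ->]]; rewrite !inE /= eqxx !andbF.
- rewrite !inE /= => /and4P[_ _ _ pqm] /andP[_ /and4P[_ _ /eqP eqm pqa]].
  by move: eqm; rewrite (nright_setD1 _ _ aA) (ccw_asym pqa); lia.
Qed.

(** Each hull vertex peeled off accounts for one increment of the binomial. Since [nedges A m]
    counts the (<= m - 1)-edges, this is 3 binom(k+2, 2) with k = m - 1. *)
Lemma edges_lower_bound (A : {set T}) m : 2 * m < #|A| -> 3 * 'C(m.+1, 2) <= nedges A m.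
Proof.
elim: m A => [|m IH] A mA; first by rewrite muln0.
have [|a exa] := @extreme_exists A; first by rewrite -card_gt0; lia.
have [aA _] := extremeP _ _ exa.
have mA' : 2 * m < #|A :\ a| by have := cardsD1 a A; rewrite aA; lia.
by rewrite [ 'C(m.+2, 2)]binS bin1; have := edges_rec exa mA; have := IH _ mA'; lia.
Qed.

(** * Hull edges and triangular hulls *)

Definition extremes (A : {set T}) : {set T} := [set a | extreme A a].

(** All other points lie strictly left of [a -> b], so [b] serves as the reference direction in
    [ccw_trans_left]. *)
Lemma succ_extreme (A : {set T}) a b : a \in A -> b \in A -> a != b ->
  nright A a b = 0 -> extreme A a.
Proof.
move=> aA bA ab /cards0_eq noR; apply/extremeP; split=> // p q r pA qA rA pq qr.
have R0 z : z \in A -> ccw a z b = false.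
  by move=> zA; move/setP/(_ z): noR; rewrite !inE zA.
have left z : z \in A -> a != z -> z != b -> ccw a b z.
  by move=> zA az zb; rewrite ccw_total ?R0 // eq_sym.
have [ap aq _] := ccw_neq pq; have [_ ar _] := ccw_neq qr.
have [eq_qb|qb] := eqVneq q b; first by rewrite eq_qb R0 in pq.
have [eq_rb|rb] := eqVneq r b; first by rewrite eq_rb R0 in qr.
have [->|pb] := eqVneq p b; first exact: left.
by apply: (@ccw_trans_left a b p q r); rewrite ?left.
Qed.

Lemma pred_extreme (A : {set T}) a b : a \in A -> b \in A -> a != b ->
  nright A a b = 0 -> extreme A b.
Proof.
move=> aA bA ab /cards0_eq noR; apply/extremeP; split=> // p q r pA qA rA pq qr.
have R0 z : z \in A -> ccw b a z = false.
  by move=> zA; move/setP/(_ z): noR; rewrite !inE zA /= -ccw_cycle.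
have left z : z \in A -> b != z -> z != a -> ccw b z a.
  by move=> zA bz za; rewrite ccw_total ?R0 // eq_sym.
have [bp bq _] := ccw_neq pq; have [_ br _] := ccw_neq qr.
have [eq_pa|pa] := eqVneq p a; first by rewrite eq_pa R0 in pq.
have [eq_qa|qa] := eqVneq q a; first by rewrite eq_qa R0 in qr.
have [->|ra] := eqVneq r a; first exact: left.
by apply: (@ccw_trans_right b a p q r); rewrite ?left.
Qed.

Lemma extreme_succ (A : {set T}) a : extreme A a -> 1 < #|A| ->
  exists2 b, extreme A b & a != b /\ nright A a b = 0.
Proof.
move=> exa A1; have [aA _] := extremeP _ _ exa.
have /eqP/cards1P[b /setP/(_ b)] := card_outs exa A1.
rewrite !inE eqxx ltnS leqn0 => /andP[/andP[ba bA] /eqP ab0].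
by exists b; [apply: pred_extreme ab0; rewrite // eq_sym|rewrite eq_sym].
Qed.

(** The 0-edges are the hull edges, and each hull vertex is the tail of exactly one. *)
Lemma nedges1 (A : {set T}) : 1 < #|A| -> nedges A 1 = #|extremes A|.
Proof.
move=> A1; rewrite /nedges -(@card_in_imset _ _ fst).
  apply: eq_card => a; rewrite inE; apply/imsetP/idP.
    case=> -[p q]; rewrite inE /= ltnS leqn0 => /and4P[pA qA pq /eqP pq0] ->.
    exact: succ_extreme pq0.
  move=> exa; have [b /extremeP[bA _] [ab ab0]] := extreme_succ exa A1.
  have [aA _] := extremeP _ _ exa.
  by exists (a, b); rewrite // inE /= aA bA ab ab0.
move=> [p q] [p' q']; rewrite !inE /= => /and4P[pA qA pq pq0] /and4P[_ qA' pq' pq0'] eqp.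
subst p'; congr (_, _).
have exp : extreme A p by apply: (@succ_extreme _ p q) => //; move: pq0; rewrite ltnS leqn0 => /eqP.
apply: (nright_inj exp); rewrite ?inE ?qA ?qA' 1?eq_sym ?pq ?pq' //.
by move: pq0 pq0'; rewrite !ltnS !leqn0 => /eqP -> /eqP ->.
Qed.

Definition hull_triangle (A : {set T}) a b c : Prop :=
  [/\ [/\ extreme A a, extreme A b & extreme A c],
      [/\ nright A a b = 0, nright A b c = 0 & nright A c a = 0],
      ccw a b c &
      {in A :\: [set a; b; c], forall p, [/\ ccw p a b, ccw p b c & ccw p c a]}].

Lemma set3_rot (a b c : T) : [set b; c; a] = [set a; b; c].
Proof. by apply/setP=> x; rewrite !inE orbC orbA. Qed.

Lemma hull_triangle_rot (A : {set T}) a b c :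
  hull_triangle A a b c -> hull_triangle A b c a.
Proof.
case=> -[exa exb exc] [ab bc ca] abc inner; split=> //; first by rewrite -ccw_cycle.
by rewrite set3_rot => p /inner[].
Qed.

(** Follow the hull edges through [a], [b], [c], [d]. A hull edge whose reverse is also one leaves
    no third point, so with three hull vertices the walk closes up with [d = a]. *)
Lemma extremes3_triangle (A : {set T}) : 2 < #|A| -> #|extremes A| = 3 ->
  exists a b c, extremes A = [set a; b; c] /\ hull_triangle A a b c.
Proof.
move=> A2 ext3; have A1 : 1 < #|A| by lia.
have /set0Pn[a] : extremes A != set0 by rewrite -card_gt0 ext3.
rewrite inE => exa.
have [b exb [ab ab0]] := extreme_succ exa A1.
have [c exc [bc bc0]] := extreme_succ exb A1.
have [d exd [cd cd0]] := extreme_succ exc A1.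
have no2 p q : extreme A p -> extreme A q -> p != q ->
    nright A p q = 0 -> nright A q p = 0 -> False.
  move=> /extremeP[pA _] /extremeP[qA _] pq pq0 qp0.
  by move: A2; rewrite -(nright_opp pA qA pq) pq0 qp0.
have ca : c != a by apply/eqP=> e; subst c; exact: (no2 a b exa exb ab ab0 bc0).
have db : d != b by apply/eqP=> e; subst d; exact: (no2 b c exb exc bc bc0 cd0).
have eqE : extremes A = [set a; b; c].
  apply/esym/eqP; rewrite eqEcard ext3; apply/andP; split.
    by apply/subsetP=> x; rewrite !inE -orbA => /or3P[] /eqP ->.
  by rewrite -setUA cardsU1 cards2 !inE bc (negbTE ab) eq_sym (negbTE ca).
have da : d = a.
  have : d \in extremes A by rewrite inE.
  by rewrite eqE !inE (negbTE db) [d == c]eq_sym (negbTE cd) !orbF => /eqP.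
subst d.
have left p q r : p != q -> r \in A -> r != p -> r != q -> nright A p q = 0 -> ccw p q r.
  move=> pq rA rp rq /cards0_eq/setP/(_ r); rewrite !inE rA /= => rn.
  by rewrite ccw_total ?rn // eq_sym.
have [cA _] := extremeP _ _ exc.
exists a, b, c; split=> //; split=> //; first by apply: left; rewrite // eq_sym.
move=> p; rewrite !inE !negb_or -!andbA => /and4P[pa pb pc pA].
by split; rewrite ccw_cycle; apply: left.
Qed.

Lemma extremes_delete (A : {set T}) u :
  extremes A :\ u \subset extremes (A :\ u).
Proof.
apply/subsetP=> x; rewrite !inE => /andP[xu exx].
apply: (extreme_sub _ _ exx); first exact: subsetDl.
by rewrite !inE xu; case/extremeP: exx.
Qed.

(* If there were four extreme points, an inner point [p] would lie in each of
   the triangles that they span, so the tournament [ccw p] would be cyclic on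
   every triple; in such a tournament all in- and outdegrees are at most 1. *)
Lemma extremes3_of_deletions (A : {set T}) : 4 < #|A| ->
  {in extremes A, forall a, #|extremes (A :\ a)| = 3} -> #|extremes A| <= 3.
Proof.
move=> A4 del3; rewrite leqNgt; apply/negP=> ext4.
have card4 : #|extremes A| = 4.
  have /set0Pn[a aE] : extremes A != set0 by rewrite -card_gt0; lia.
  have := subset_leq_card (extremes_delete A a); rewrite del3 //.
  by have := cardsD1 a (extremes A); rewrite aE; lia.
have /subsetPn[p pA pE] : ~~ (A \subset extremes A).
  by apply/negP=> /subset_leq_card; lia.
have cyclic v w t : v \in extremes A -> w \in extremes A -> t \in extremes A ->
    v != w -> v != t -> w != t -> ccw p v w -> ccw p w t && ccw p t v.
  move=> vE wE tE vw vt wt pvw.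
  (* [u] is the fourth hull vertex; once it is deleted, [v], [w], [t] span the hull, with [p]
     inside. *)
  have [u uE uN] : exists2 u, u \in extremes A & u \notin [set v; w; t].
    apply/subsetPn/negP=> /subset_leq_card.
    by rewrite card4 -setUA cardsU1 cards2; case: (_ \notin _); case: (_ != _).
  have [x [y [z [eqE [_ _ _ inner]]]]] : exists x y z,
      extremes (A :\ u) = [set x; y; z] /\ hull_triangle (A :\ u) x y z.
    apply: extremes3_triangle (del3 u uE).
    by rewrite -ltnS (leq_trans (ltnW A4)) ?card_setD1_geq.
  have eqDu : extremes A :\ u = [set x; y; z].
    apply/eqP; rewrite -eqE eqEcard extremes_delete del3 //.
    by move: card4; rewrite (cardsD1 u) uE add1n => -[->].
  move: uN; rewrite !inE !negb_or -andbA => /and3P[uv uw ut].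
  have pu : p != u by apply: contraNneq pE => ->.
  have [|pxy pyz pzx] := inner p; first by rewrite -eqDu in_setD !in_setD1 pu pA (negbTE pE).
  have mem s : s \in extremes A -> u != s -> [\/ s = x, s = y | s = z].
    move=> sE us; have : s \in extremes A :\ u by rewrite in_setD1 eq_sym us.
    by rewrite eqDu !inE -orbA => /or3P[] /eqP ->; [constructor 1|constructor 2|constructor 3].
  have [pyx pzy pxz] := And3 (ccw_asym pxy) (ccw_asym pyz) (ccw_asym pzx).
  move: (mem v vE uv) (mem w wE uw) (mem t tE ut) vw vt wt pvw.
  by do 3 case=> ->; rewrite ?eqxx ?pyx ?pzy ?pxz ?pxy ?pyz ?pzx.
have /card_gt0P[v vE] : 0 < #|extremes A| by lia.
have pne s : s \in extremes A -> p != s by move=> sE; apply: contraNneq pE => ->.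
(* Two successors [w], [t] of [v] would contradict [cyclic], which forces [ccw p t v]. *)
have card_out : #|[set w in extremes A | ccw p v w]| <= 1.
  apply/card_le1_eqP=> w t; rewrite 2!in_set => /andP[wE vw] /andP[tE vt].
  apply/eqP; apply: contraT; rewrite eq_sym => wt.
  have [_ _ nvw] := ccw_neq vw; have [_ _ nvt] := ccw_neq vt.
  by have /andP[_] := cyclic v w t vE wE tE nvw nvt wt vw; rewrite (ccw_asym vt).
have card_in : #|[set w in extremes A | ccw p w v]| <= 1.
  apply/card_le1_eqP=> w t; rewrite 2!in_set => /andP[wE wv] /andP[tE tv].
  apply/eqP; apply: contraT; rewrite eq_sym => wt.
  have [_ _ nwv] := ccw_neq wv; have [_ _ ntv] := ccw_neq tv.
  have := cyclic w v t wE vE tE nwv wt; rewrite eq_sym => /(_ ntv wv) /andP[].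
  by rewrite (ccw_asym tv).
suff : extremes A \subset v |: ([set w in extremes A | ccw p v w] :|:
                                [set w in extremes A | ccw p w v]).
  move/subset_leq_card; rewrite card4 cardsU1 cardsU; case: (_ \notin _); lia.
apply/subsetP=> w wE; have := wE; rewrite !inE => ->.
have [//|wv] := eqVneq w v.
by rewrite /= (ccw_total (pne v vE) (pne w wE)) 1?eq_sym // orNb.
Qed.
Lemma hull_triangle_mem (A : {set T}) a b c : hull_triangle A a b c ->
  [/\ a \in A, b \in A & c \in A] /\ [/\ a != b, a != c & b != c].
Proof. by case=> -[/extremeP[? _] /extremeP[? _] /extremeP[? _]] _ /ccw_neq. Qed.

(** Only [b] can be lost: it has rank 0 around [a], whereas [c] comes last, with rank above [m]. *)
Lemma card_outs_inner (A : {set T}) a b c m :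
  hull_triangle A a b c -> 2 * m.+1 < #|A| ->
  m <= #|outs A a m.+1 :\: [set a; b; c]|.
Proof.
move=> H mA; have [[exa _ exc] [_ _ ca0] _ _] := H.
have [[aA bA cA] [ab ac bc]] := hull_triangle_mem H.
have lt_ac : m < nright A a c by have := nright_opp aA cA ac; lia.
have sub : outs A a m.+1 \subset b |: (outs A a m.+1 :\: [set a; b; c]).
  apply/subsetP=> x xO; rewrite !in_setU1 in_setD xO andbT !inE.
  move: xO; rewrite !inE => /andP[/andP[xa xA] xm]; rewrite (negbTE xa) /=.
  have [//|xb /=] := eqVneq x b; apply: contraTneq xm => ->.
  by rewrite -leqNgt.
have := subset_leq_card sub; rewrite card_outs // ?cardsU1.
  by case: (_ \notin _); rewrite ?add1n // add0n => /ltnW.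
by move: mA; rewrite mul2n -addnn; apply: leq_ltn_trans; apply: leq_addr.
Qed.

Lemma card_ins_inner (A : {set T}) a b c m :
  hull_triangle A a b c -> 2 * m.+1 < #|A| ->
  m <= #|ins A a m.+1 :\: [set a; b; c]|.
Proof.
move=> H mA; have [[exa _ exc] [ab0 _ _] _ _] := H.
have [[aA bA cA] [ab ac bc]] := hull_triangle_mem H.
have lt_ba : m < nright A b a by have := nright_opp aA bA ab; lia.
have sub : ins A a m.+1 \subset c |: (ins A a m.+1 :\: [set a; b; c]).
  apply/subsetP=> x xO; rewrite !in_setU1 in_setD xO andbT !inE.
  move: xO; rewrite !inE => /andP[/andP[xa xA] xm]; rewrite (negbTE xa) /=.
  have [//|xc /=] := eqVneq x c; rewrite orbF; apply: contraTneq xm => ->.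
  by rewrite -leqNgt.
have := subset_leq_card sub; rewrite card_ins // ?cardsU1.
  by case: (_ \notin _); rewrite ?add1n // add0n => /ltnW.
by move: mA; rewrite mul2n -addnn; apply: leq_ltn_trans; apply: leq_addr.
Qed.

(** A line through an inner point cannot have all three hull vertices on its right. *)
Lemma nright_triangle (A : {set T}) a b c p q : hull_triangle A a b c ->
  p \in A :\: [set a; b; c] ->
  nright A p q <= (nright (A :\: [set a; b; c]) p q).+2.
Proof.
move=> [_ _ _ inner] /inner[ab bc ca]; set S := A :\: _.
suff [x [y sub]] : exists x y, right A p q \subset [set x; y] :|: right S p q.
  rewrite /nright; apply: leq_trans (subset_leq_card sub) _.
  rewrite cardsU cards2; apply: leq_trans (leq_subr _ _) _.
  by rewrite -addn2 addnC leq_add2l; case: (_ != _).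
have [aq|aq] := boolP (ccw p a q); last first.
  exists b, c; apply/subsetP=> r; rewrite !inE => /andP[rA rq].
  have ra : r != a by apply: contraNneq aq => <-.
  by rewrite rA rq (negbTE ra); case: (r == b); case: (r == c).
have [bq|bq] := boolP (ccw p b q); last first.
  exists a, c; apply/subsetP=> r; rewrite !inE => /andP[rA rq].
  have rb : r != b by apply: contraNneq bq => <-.
  by rewrite rA rq (negbTE rb); case: (r == a); case: (r == c).
exists a, b; apply/subsetP=> r; rewrite !inE => /andP[rA rq].
have rc : r != c.
  apply: contraTneq rq => ->; apply/negP=> cq.
  by have := ccw_trans_right aq bq cq ab bc; rewrite (ccw_asym ca).
by rewrite rA rq (negbTE rc); case: (r == a); case: (r == b).
Qed.

(* The term [6 * m.+1 + 3] counts the [m.+1] edges from, and the [m.+1] edges to,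
   each hull vertex with the other end inside, and the three hull edges. *)
Lemma triangle_rec (A : {set T}) a b c m (S := A :\: [set a; b; c]) :
  hull_triangle A a b c -> 2 * m.+2 < #|A| ->
  nedges S m + 6 * m.+1 + 3
  + #|[set pq : T * T | [&& pq.1 \in S, pq.2 \in S, pq.1 != pq.2,
         nright A pq.1 pq.2 == m.+1 & m <= nright S pq.1 pq.2]]|
  <= nedges A m.+2.
Proof.
move=> H mA; have [_ [ab0 bc0 ca0] _ inner] := H.
have [[aA bA cA] [ab ac bc]] := hull_triangle_mem H.
set X := [set _ | _]; set E3 := [set a; b; c] in S inner X *.
have HS p : p \in E3 -> p \in S = false by move=> pH; rewrite inE pH.
have HA p : p \in E3 -> p \in A by rewrite !inE -orbA => /or3P[] /eqP ->.
have SA p : p \in S -> p \in A by rewrite inE => /andP[].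
have HSne p q : p \in E3 -> q \in S -> p != q.
  by move=> pH qS; apply: contraTneq qS => <-; rewrite HS.
have rots : [/\ hull_triangle A a b c, hull_triangle A b c a & hull_triangle A c a b].
  by split=> //; [|apply: hull_triangle_rot]; apply: hull_triangle_rot.
have eqb : E3 = [set b; c; a] by rewrite (set3_rot a b c).
have eqc : E3 = [set c; a; b] by rewrite (set3_rot b c a).
have sumE3 F : \sum_(p in E3) F p = F a + (F b + F c).
  rewrite /E3 -setUA big_setU1 ?inE ?negb_or ?ab ?ac //=.
  by rewrite big_setU1 ?inE //= big_set1.
pose O := [set pq : T * T | (pq.1 \in E3) &&
             ((pq.2 \in S) && (nright A pq.1 pq.2 < m.+2))].
pose I := [set pq : T * T | (pq.2 \in E3) &&
             ((pq.1 \in S) && (nright A pq.1 pq.2 < m.+2))].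
have cardO : 3 * m.+1 <= #|O|.
  rewrite (card_pairs_fst E3 (fun p q => (q \in S) && (nright A p q < m.+2))) sumE3.
  have le x y z : E3 = [set x; y; z] -> hull_triangle A x y z ->
      m.+1 <= #|[set q | (q \in S) && (nright A x q < m.+2)]|.
    move=> eqE Hx; apply: leq_trans (card_outs_inner Hx mA) (subset_leq_card _).
    by apply/subsetP=> q; rewrite -eqE !inE => /andP[-> /andP[/andP[_ ->] ->]].
  have [Ha Hb Hc] := rots.
  by move: (le _ _ _ erefl Ha) (le _ _ _ eqb Hb) (le _ _ _ eqc Hc); clear; lia.
have cardI : 3 * m.+1 <= #|I|.
  rewrite (card_pairs_snd E3 (fun p q => (p \in S) && (nright A p q < m.+2))) sumE3.
  have le x y z : E3 = [set x; y; z] -> hull_triangle A x y z ->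
      m.+1 <= #|[set q | (q \in S) && (nright A q x < m.+2)]|.
    move=> eqE Hx; apply: leq_trans (card_ins_inner Hx mA) (subset_leq_card _).
    by apply/subsetP=> q; rewrite -eqE !inE => /andP[-> /andP[/andP[_ ->] ->]].
  have [Ha Hb Hc] := rots.
  by move: (le _ _ _ erefl Ha) (le _ _ _ eqb Hb) (le _ _ _ eqc Hc); clear; lia.
pose C := [set (a, b); (b, c); (c, a)].
have cardC : #|C| = 3.
  by rewrite /C -setUA cardsU1 cards2 !inE !xpair_eqE (negbTE ab) (negbTE bc) (negbTE ac).
(* An edge of [X] has too many inner points on its right to lie in [edges S m], so the five families
   are disjoint. *)
apply: (@leq_trans (#|C| + (#|O| + (#|I| + (nedges S m + #|X|))))).
  by rewrite cardC; move: cardO cardI; clear; lia.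
have := @sum_card_disjoint _ (edges A m.+2) [:: C; O; I; edges S m; X].
rewrite /= !andbT addn0; apply.
  apply/and5P; split; apply/subsetP=> -[p q].
  - rewrite !inE -orbA !xpair_eqE => /or3P[] /andP[/eqP -> /eqP ->] /=.
    + by rewrite aA bA ab ab0.
    + by rewrite bA cA bc bc0.
    + by rewrite aA cA eq_sym ac ca0.
  - rewrite [_ \in O]inE [_ \in edges _ _]inE /= => /and3P[pH qS ->].
    by rewrite (HA p) ?(SA q) ?HSne.
  - rewrite [_ \in I]inE [_ \in edges _ _]inE /= => /and3P[qH pS ->].
    by rewrite (SA p) ?(HA q) 1?eq_sym ?HSne.
  - rewrite ![_ \in edges _ _]inE /= => /and4P[pS qS -> pq].
    rewrite (SA p) ?(SA q) //=; apply: leq_ltn_trans (nright_triangle _ H pS) _.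
    by rewrite !ltnS.
  - rewrite [_ \in X]inE [_ \in edges _ _]inE /= => /and5P[pS qS -> /eqP -> _].
    by rewrite (SA p) ?(SA q) ?leqnn.
have dis (Y Z : {set T * T}) : (forall p q, (p, q) \in Y -> (p, q) \in Z -> false) ->
    [disjoint Y & Z].
  by move=> YZ; apply/pred0P=> -[p q] /=; apply/negP=> /andP[/YZ h /h].
have CE p q : (p, q) \in C -> (p \in E3) && (q \in E3).
  rewrite !inE -orbA !xpair_eqE => /or3P[] /andP[/eqP -> /eqP ->];
    by rewrite !eqxx ?orbT.
apply/and4P; split; [apply/and4P; split|apply/and3P; split|apply/andP; split|];
  apply: dis => p q.
- by move=> /CE/andP[pH qH]; rewrite inE /= (HS q) // andbF.
- by move=> /CE/andP[pH qH]; rewrite inE /= (HS p) // andbF.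
- by move=> /CE/andP[pH qH]; rewrite inE /= (HS p).
- by move=> /CE/andP[pH qH]; rewrite inE /= (HS p).
- by rewrite ![(p, q) \in _]inE /= => /and3P[pH _ _]; rewrite (HS p) // andbF.
- by rewrite ![(p, q) \in _]inE /= => /and3P[pH _ _]; rewrite (HS p).
- by rewrite ![(p, q) \in _]inE /= => /and3P[pH _ _]; rewrite (HS p).
- by rewrite ![(p, q) \in _]inE /= => /and3P[qH _ _]; rewrite (HS q) // andbF.
- by rewrite ![(p, q) \in _]inE /= => /and3P[qH _ _]; rewrite (HS q) // andbF.
- rewrite ![(p, q) \in _]inE /= => /and4P[_ _ _ lt_m] /and5P[_ _ _ _].
  by rewrite leqNgt lt_m.
Qed.

(** * Exact counts and the tight case *)

Lemma nrightpp (A : {set T}) p : nright A p p = 0.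
Proof.
apply/eqP; rewrite cards_eq0; apply/eqP/setP=> r; rewrite !inE.
by apply/negP=> /andP[_ /ccw_neq[_]]; rewrite eqxx.
Qed.

Definition kedges (A : {set T}) m : {set T * T} :=
  [set pq | [&& pq.1 \in A, pq.2 \in A, pq.1 != pq.2 & nright A pq.1 pq.2 == m]].

Lemma nedgesS (A : {set T}) m : nedges A m.+1 = nedges A m + #|kedges A m|.
Proof.
rewrite /nedges -(cardsID (edges A m) (edges A m.+1)); congr (_ + _);
  apply: eq_card => -[p q]; rewrite !inE /=;
  case: (p \in A); case: (q \in A); case: (p != q) => //=; rewrite ltnS; lia.
Qed.

Lemma nedges_sum (A : {set T}) m : nedges A m = \sum_(0 <= j < m) #|kedges A j|.
Proof.
elim: m => [|m IH]; last by rewrite nedgesS big_nat_recr //= IH.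
by rewrite big_geq //; apply: eq_card0 => pq; rewrite inE ltn0 !andbF.
Qed.

(* A point of the difference would be the tail of an [m.+1]-edge with [a] and [c]
   on its left, hence with at most one hull vertex on its right. *)
Lemma outs_eq_ins (A : {set T}) a b c m (S := A :\: [set a; b; c]) :
  hull_triangle A a b c -> 2 * m.+2 < #|A| ->
  {in S &, forall p q, nright A p q = m.+1 -> nright S p q < m} ->
  outs A a m.+2 = ins A c m.+2.
Proof.
move=> H mA noX; have [[exa exb exc] [ab0 bc0 ca0] _ inner] := H.
have [[aA bA cA] [ab ac bc]] := hull_triangle_mem H.
have mA' : m.+2 < #|A| by move: mA; clear; lia.
have lt_ac : m.+1 < nright A a c.
  by have := nright_opp aA cA ac; move: mA; rewrite ca0; clear; lia.
(* Both sets have [m.+2] elements, so one inclusion suffices. *)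
apply/eqP; rewrite eqEcard card_outs ?card_ins ?leqnn ?andbT //.
apply/subsetP=> x; rewrite [_ \in outs _ _ _]inE in_setD1 => /andP[/andP[xa xA] x_out].
have xc : x != c by apply: contraTneq x_out => ->; rewrite -leqNgt.
rewrite inE in_setD1 xc xA /=.
have [->|xb] := eqVneq x b; first by rewrite bc0.
have xS : x \in S by rewrite !inE !negb_or xa xb xc xA.
have [xab xbc xca] := inner x xS.
rewrite ltnNge; apply/negP=> x_in.
have [|y yA [ym ya yc]] := rotation _ x_out x_in; first by right.
have [[_ _ nya] [_ _ nyc]] := (ccw_neq ya, ccw_neq yc).
have nyb : y != b by apply: contraTneq ya => ->; rewrite (ccw_asym xab).
have yS : y \in S by rewrite !inE !negb_or nya nyb nyc yA.
have := noX x y xS yS ym; apply/negP; rewrite -leqNgt -ltnS -{1}ym.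
have sub : right A x y \subset b |: right S x y.
  apply/subsetP=> r; rewrite !inE => /andP[rA ry].
  have ra : r != a by apply: contraTneq ry => ->; rewrite (ccw_asym ya).
  have rc : r != c by apply: contraTneq ry => ->; rewrite (ccw_asym yc).
  by rewrite rA ry (negbTE ra) (negbTE rc); case: (r == b).
apply: leq_trans (subset_leq_card sub) _.
by rewrite cardsU1 -add1n leq_add2r leq_b1.
Qed.

(** Rotating about [x] from [a -> x] to [x -> a] produces an [m]-edge with tail [x]. *)
Lemma card_kedges_outs (A : {set T}) (U : {set T}) m :
  (forall x, x \in U -> exists2 a, a \in A & x \in outs A a m.+1) ->
  2 * m.+1 < #|A| -> #|U| <= #|kedges A m|.
Proof.
move=> outU mA; apply: leq_trans (leq_imset_card fst (kedges A m)).
apply/subset_leq_card/subsetP=> x /outU[a aA]; rewrite !inE => /andP[/andP[xa xA] x_out].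
have x_in : m < nright A x a.
  by have := nright_opp xA aA xa; move: mA x_out; clear; lia.
have [|y yA [ym ya _]] := rotation _ x_out x_in; first by left.
have [xy _ _] := ccw_neq ya.
by apply/imsetP; exists (x, y); rewrite // !inE /= xA yA xy ym eqxx.
Qed.

(** The last hypothesis stands for the induction hypothesis of [tight_nedges]. It is applied to
    [A :\ a], which inherits tightness by [edges_rec] and [edges_lower_bound]. *)
Lemma tight_extremes (A : {set T}) m : 0 < m -> 3 * m.+1 <= #|A| ->
  nedges A m.+1 = 3 * 'C(m.+2, 2) ->
  (forall B : {set T}, 3 * m <= #|B| ->
     nedges B m = 3 * 'C(m.+1, 2) -> nedges B 1 = 3) ->
  #|extremes A| = 3.
Proof.
move=> m0 mA tight IH.
have A4 : 4 < #|A| by move: m0 mA; clear; lia.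
have A1 : 1 < #|A| by move: A4; clear; lia.
have mA2 : 2 * m.+1 < #|A| by move: m0 mA; clear; lia.
apply/eqP; rewrite eqn_leq -(nedges1 A1); apply/andP; split; last first.
  have := @edges_lower_bound A 1; rewrite binn muln1; apply.
  by move: A4; clear; lia.
rewrite nedges1 //; apply: extremes3_of_deletions => // a; rewrite inE => exa.
have [aA _] := extremeP _ _ exa.
have cardA : #|A| = #|A :\ a|.+1 by rewrite (cardsD1 a) aA.
rewrite -nedges1; last by move: A4; rewrite cardA; clear; lia.
apply: IH; first by move: mA; rewrite cardA; clear; lia.
have := edges_rec exa mA2; rewrite tight [ 'C(m.+2, 2)]binS bin1.
have : 3 * 'C(m.+1, 2) <= nedges (A :\ a) m.
  by apply: edges_lower_bound; move: mA2; rewrite cardA; clear; lia.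
clear; lia.
Qed.

Lemma tight_nedges (A : {set T}) m : 3 * m <= #|A| ->
  nedges A m = 3 * 'C(m.+1, 2) ->
  forall j, j <= m -> nedges A j = 3 * 'C(j.+1, 2).
Proof.
elim: m A => [|m IH] A mA tight j; first by rewrite leqn0 => /eqP ->.
have nedges0 : nedges A 0 = 0 by rewrite nedges_sum big_geq.
rewrite leq_eqVlt ltnS => /orP[/eqP -> //|]; move: j.
case: m IH mA tight => [|m] IH mA tight; first by move=> j; rewrite leqn0 => /eqP ->.
have mA2 : 2 * m.+2 < #|A| by move: mA; clear; lia.
have ext3 : #|extremes A| = 3.
  by apply: (@tight_extremes A m.+1) => // B mB tightB; rewrite (IH B).
have [|a [b [c [_ H]]]] := extremes3_triangle _ ext3; first by move: mA; clear; lia.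
have [[aA bA cA] [ab ac bc]] := hull_triangle_mem H.
set S := A :\: [set a; b; c].
have cardS : #|A| <= #|S| + 3.
  rewrite -(cardsID [set a; b; c] A) addnC leq_add2l.
  apply: leq_trans (subset_leq_card (subsetIr _ _)) _.
  by rewrite -setUA cardsU1 cards2; case: (_ \notin _); case: (_ != _).
(* Since 3 binom(m+3, 2) = 3 binom(m+1, 2) + 6(m+1) + 3, [triangle_rec] leaves no room for even one
   edge in its last family. *)
have noX : {in S &, forall p q, nright A p q = m.+1 -> nright S p q < m}.
  move=> p q pS qS pqm; rewrite ltnNge; apply/negP=> Sm.
  have pq : p != q by apply: contra_eqN pqm => /eqP ->; rewrite nrightpp.
  have lbS : 3 * 'C(m.+1, 2) <= nedges S m.
    by apply: edges_lower_bound; move: mA cardS; clear; lia.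
  have := triangle_rec H mA2; rewrite tight -/S; set X := [set _ | _].
  have : 0 < #|X|.
    by apply/card_gt0P; exists (p, q); rewrite inE /= pS qS pq pqm eqxx Sm.
  move: lbS; rewrite [ 'C(m.+3, 2)]binS bin1 [ 'C(m.+2, 2)]binS bin1; clear; lia.
have Hb := hull_triangle_rot H; have Hc := hull_triangle_rot Hb.
have eqa : outs A a m.+2 = ins A c m.+2 by apply: outs_eq_ins noX.
have eqb : outs A b m.+2 = ins A a m.+2.
  by apply: (outs_eq_ins Hb mA2); rewrite set3_rot.
have eqc : outs A c m.+2 = ins A b m.+2.
  by apply: (outs_eq_ins Hc mA2); rewrite 2!set3_rot.
have [[exa exb exc] _ _ _] := H.
have card_outs2 x : extreme A x -> #|outs A x m.+2| = m.+2.
  by move=> exx; apply: card_outs => //; move: mA; clear; lia.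
(* By [eqa], [eqb] and [eqc], any two of these sets are the [outs] and the [ins] of one hull vertex,
   hence disjoint. *)
pose U := outs A a m.+2 :|: outs A b m.+2 :|: outs A c m.+2.
have cardU : #|U| = 3 * m.+2.
  rewrite /U !cardsU setIUl !card_outs2 //.
  have := disjoint_outs_ins aA mA2; rewrite -eqb => /disjoint_setI0 ->.
  have := disjoint_outs_ins cA mA2; rewrite -eqa disjoint_sym => /disjoint_setI0 ->.
  have := disjoint_outs_ins bA mA2; rewrite -eqc => /disjoint_setI0 ->.
  by rewrite setU0 cards0; clear; lia.
have lbk : 3 * m.+2 <= #|kedges A m.+1|.
  rewrite -cardU; apply: card_kedges_outs => // x.
  by rewrite !in_setU -orbA => /or3P[]; [exists a|exists b|exists c].
have lbA : 3 * 'C(m.+2, 2) <= nedges A m.+1.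
  by apply: edges_lower_bound; move: mA; clear; lia.
apply: IH; first by move: mA; clear; lia.
(* The lower bounds for the two summands add up to the tight total, so both are attained. *)
move: tight lbk lbA; rewrite nedgesS [ 'C(m.+3, 2)]binS bin1; clear; lia.
Qed.

End Planar.

(** * From a finite set of points to the finite type of its elements *)

Section Transfer.
Local Set Implicit Arguments.
Local Unset Strict Implicit.
Local Open Scope fset_scope.
Variables (R : realType) (S : {fset R * R}).

Lemma right_of_det (p q r : R * R) : right_of p q r = (0 < det p r q)%R.
Proof. by rewrite /right_of /dot /right_normal /det /=; congr (0 < _)%R; ring. Qed.

Lemma general_position_det : general_position S -> forall p q r : S,
  p != q -> p != r -> q != r -> det (val p) (val q) (val r) != 0%R.
Proof.
move=> gpS p q r pq pr qr; apply/eqP=> det0.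
apply: (gpS (val p) (val q) (val r)); rewrite ?fsvalP //.
exists (right_normal (val q - val p)%R), (dot (right_normal (val q - val p)%R) (val p)).
split; last first.
  by split=> //; move: det0; rewrite /dot /right_normal /det /=; lra.
apply: contra_neq pq => /eqP; rewrite xpair_eqE oppr_eq0 !subr_eq0 => /andP[/eqP e2 /eqP e1].
by apply: val_inj; move: e1 e2 => /=; case: (val p) (val q) => [? ?] [? ?] /= -> ->.
Qed.

Lemma card_fset_val (P : pred (R * R)) :
  #|` [fset r in S | P r]| = #|[set r : S | P (val r)]|.
Proof.
have -> : [fset r in S | P r] = [fset val r | r in [set r : S | P (val r)]].
  apply/fsetP=> r; rewrite !inE; apply/andP/imfsetP => /= [[rS Pr]|[s]].
    by exists [` rS]; rewrite ?inE.
  by rewrite inE => Ps ->; rewrite fsvalP.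
by rewrite card_imfset ?cardE //; apply: val_inj.
Qed.

Lemma card_jedges j : jedges j S = #|kedges (val : S -> R * R) [set: S] j|.
Proof.
rewrite /jedges.
have nrightE (p q : S) : nright val [set: S] p q = #|` [fset r in S | right_of (val p) (val q) r]|.
  by rewrite card_fset_val; apply: eq_card => r; rewrite !inE /ccw right_of_det.
have -> : [fset pq in S `*` S | is_jedge j S pq] =
    [fset (val pq.1, val pq.2) | pq in kedges (val : S -> R * R) [set: S] j].
  apply/fsetP=> -[p q]; rewrite !inE /=; apply/andP/imfsetP => /= [|[[p' q']]].
    case=> /andP[pS qS] /and4P[/= _ _ pq pqj].
    by exists ([` pS], [` qS]); rewrite ?inE //= nrightE pqj andbT.
  rewrite !inE /= nrightE => /andP[pq pqj] [-> ->].
  by split; last apply/and4P; rewrite /= ?fsvalP.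
by rewrite card_imfset ?cardE // => -[p q] [p' q'] [/val_inj -> /val_inj ->].
Qed.

Lemma le_kedges_nedges k : le_kedges k S = nedges (val : S -> R * R) [set: S] k.+1.
Proof. by rewrite nedges_sum; apply: eq_bigr => j _; apply: card_jedges. Qed.

End Transfer.

(* The hypothesis k < n %/ 3 is k <= floor(n/3) - 1 over the integers (the
   truncated subtraction of nat would wrongly admit k = 0 when n < 3). *)
Theorem theorem8 (R : realType) (n k : nat) (S : {fset R * R})
    (cardS : #|` S|%fset = n) (gpS : general_position S)
    (hk : (k < n %/ 3)%N) :
  le_kedges k S = (3 * 'C(k + 2, 2))%N ->
  forall j : nat, (j <= k)%N -> le_kedges j S = (3 * 'C(j + 2, 2))%N.
Proof.
rewrite le_kedges_nedges addn2 => tight j jk; rewrite le_kedges_nedges addn2.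
apply: tight_nedges tight _ _ => //.
- exact: val_inj.
- exact: general_position_det.
(* [k < n %/ 3] means [3 * k.+1 <= n]. *)
- by rewrite cardsT -cardfE cardS; move: hk; rewrite leq_divRL // mulnC.
Qed.
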